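(* Let $d\ge2$ be an integer and let $(A_{m,n})_{m,n\ge1}$ be the $d$-Ostrowski array. Then it is a $d$-Stolarsky array, i.e.: (1) each row satisfies $A_{m,n+1}=dA_{m,n}+A_{m,n-1}$ for all $n\ge2$; (2) each positive integer occurs exactly once among the entries $A_{m,n}$, $m,n\ge1$; (3) for every sequence $(B_n)$ of positive integers satisfying $B_{n+1}=dB_n+B_{n-1}$, there exists $m$ such that $(A_{m,n})_n$ and $(B_n)$ are tail equivalent.
   Context: Define $(D_n)$ by $D_0=0$, $D_1=1$, $D_{n+1}=dD_n+D_{n-1}$. An Ostrowski word is a finite word $d_1\cdots d_i$ over $\{0,\dots,d\}$ with $0\le d_1<d$, $0\le d_j\le d$ for $j>1$, and $d_{j-1}=0$ whenever $d_j=d$; it represents $\sum_j d_jD_j$. Every non-negative integer has a unique Ostrowski word with nonzero last digit. An Ostrowski word is trimmed if its last digit is nonzero and it cannot be written as $0v$ with $v$ an Ostrowski word (equivalently, its first digit is nonzero, or its first two digits are $0$ and $d$). Let $w_1,w_2,\dots$ be the trimmed Ostrowski words listed in increasing order of the integers they represent. The $d$-Ostrowski array is $A_{m,n}=$ the integer represented by $0^{n-1}w_m$, for $m,n\ge1$. Two sequences $(X_n)$, $(Y_n)$ are tail equivalent if there is an integer $j$ such that $X_n=Y_{n+j}$ for all sufficiently large $n$. *)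

(* Defs.v *)
(* Mathematical Components *)
From mathcomp Require Import all_boot all_order all_algebra.
Set Implicit Arguments.
Unset Strict Implicit.
Unset Printing Implicit Defensive.

Fixpoint Dseq (d n : nat) : nat :=
  match n with
  | 0 => 0
  | n1.+1 => match n1 with
             | 0 => 1
             | n2.+1 => d * Dseq d n1 + Dseq d n2
             end
  end.

(* The word d_1 ... d_i is the sequence [:: d_1; ...; d_i], least significant
   digit first. The last conjunct constrains each pair of adjacent digits
   (d_(j-1), d_j). The empty word is an Ostrowski word, representing 0. *)
Definition ostrowski (d : nat) (w : seq nat) : bool :=
  [&& head 0 w < d, all (fun c => c <= d) w
    & sorted (fun a b => (b == d) ==> (a == 0)) w].

(* Digits are 1-indexed on paper: nth 0 w j is d_(j+1). *)
Definition value (d : nat) (w : seq nat) : nat :=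
  \sum_(j < size w) nth 0 w j * Dseq d j.+1.

Definition trimmed (d : nat) (w : seq nat) : bool :=
  [&& ostrowski d w, last 0 w != 0
    & if w is 0 :: v then ~~ ostrowski d v else true].

(* Sequences and arrays are indexed from 1; values at index 0 are irrelevant.
   A listing is determined on m >= 1 by strict monotonicity, and exists when
   1 < d (trimmed_listing_exists). *)
Definition trimmed_listing (d : nat) (w : nat -> seq nat) : Prop :=
  [/\ forall m, 0 < m -> trimmed d (w m),
      forall v, trimmed d v -> exists2 m, 0 < m & w m = v
    & forall m1 m2, 0 < m1 -> m1 < m2 -> value d (w m1) < value d (w m2)].

Definition ostrowski_array (d : nat) (w : nat -> seq nat) (m n : nat) : nat :=
  value d (nseq n.-1 0 ++ w m).

(* k ranges over the natural number n + j, when n + j is one; the shift j may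
   be negative. *)
Definition tail_equivalent (X Y : nat -> nat) : Prop :=
  exists (j : int) (N : nat), forall n k : nat,
    N <= n -> Posz k = (Posz n + j)%R -> X n = Y k.

Definition stolarsky_array (d : nat) (A : nat -> nat -> nat) : Prop :=
  [/\ forall m n, 1 <= m -> 2 <= n -> A m n.+1 = d * A m n + A m n.-1,
      forall k, 0 < k ->
        exists! p : nat * nat, [/\ 1 <= p.1, 1 <= p.2 & A p.1 p.2 = k]
    & forall B : nat -> nat,
        (forall n, 1 <= n -> 0 < B n) ->
        (forall n, 2 <= n -> B n.+1 = d * B n + B n.-1) ->
        exists2 m, 1 <= m & tail_equivalent (A m) B].

Lemma DseqSS d n : Dseq d n.+2 = d * Dseq d n.+1 + Dseq d n.
Proof. by []. Qed.

Lemma Dseq_gt0 d n : 1 < d -> 0 < Dseq d n.+1.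
Proof.
move=> hd; elim: n => // n IH.
by rewrite DseqSS addn_gt0 muln_gt0 IH (ltnW hd).
Qed.

Lemma Dseq_ltS d n : 1 < d -> Dseq d n < Dseq d n.+1.
Proof.
move=> hd; case: n => // n; rewrite DseqSS.
apply: (@leq_trans (d * Dseq d n.+1)); last exact: leq_addr.
by rewrite -[X in X < _]mul1n ltn_pmul2r // Dseq_gt0.
Qed.

Lemma leq_Dseq d n : 1 < d -> n <= Dseq d n.
Proof. by move=> hd; elim: n => // n IH; apply: leq_ltn_trans IH (Dseq_ltS n hd). Qed.

Lemma value_rcons d w c :
  value d (rcons w c) = value d w + c * Dseq d (size w).+1.
Proof.
rewrite /value size_rcons big_ord_recr /= nth_rcons ltnn eqxx; congr (_ + _).
by apply: eq_bigr => j _; rewrite nth_rcons ltn_ord.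
Qed.

Lemma ostrowski_rcons d w c : 1 < d -> ostrowski d (rcons w c) ->
  [/\ ostrowski d w, c <= d, (c == d) ==> (last 0 w == 0)
    & (w == [::]) ==> (c < d)].
Proof.
move=> hd /and3P[h1 h2 h3]; move: h2; rewrite all_rcons => /andP[hc h2].
case: w h1 h2 h3 => [|a w] /=.
  by move=> h _ _; split=> //; rewrite ?eqxx ?implybT // /ostrowski /= (ltnW hd).
rewrite rcons_path => h1 h2 /andP[h3 h4]; split=> //.
by rewrite /ostrowski /= h1 h2.
Qed.

Lemma ostrowski_bound d w : 1 < d -> ostrowski d w ->
  value d w < Dseq d (size w).+1.
Proof.
move=> hd; have [n] := ubnP (size w); elim: n w => // n IH w.
case/lastP: w => [|w c]; first by rewrite /value big_ord0.
rewrite size_rcons ltnS => hn /(ostrowski_rcons hd)[hw hc hl hn0].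
rewrite value_rcons.
have hvw := IH _ hn hw.
case: (ltnP c d) => hcd.
  rewrite DseqSS; apply: (@leq_trans (d * Dseq d (size w).+1)); last exact: leq_addr.
  by apply: leq_trans (leq_mul hcd (leqnn _)); rewrite mulSn ltn_add2r.
have ecd : c = d by apply/eqP; rewrite eqn_leq hc.
move: hl hn0; rewrite ecd eqxx implyTb => /eqP hl.
rewrite ltnn implybF => hne.
case/lastP: w hn hw hl hne {hvw} => // w e hn hw.
rewrite last_rcons => e0 _; move: hw; rewrite e0 => /(ostrowski_rcons hd)[hw _ _ _].
rewrite value_rcons mul0n addn0 size_rcons DseqSS addnC ltn_add2l.
by apply: IH => //; move: hn; rewrite size_rcons => /ltnW.
Qed.

Lemma ostrowski_inj d v w : 1 < d -> ostrowski d v -> ostrowski d w ->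
  size v = size w -> value d v = value d w -> v = w.
Proof.
move=> hd; elim/last_ind: v w => [|v a IH] w.
  by move=> _ _ /esym /size0nil.
case/lastP: w => [|w b]; first by rewrite size_rcons.
move=> /(ostrowski_rcons hd)[hv _ _ _] /(ostrowski_rcons hd)[hw _ _ _].
rewrite !size_rcons => -[es]; rewrite !value_rcons => ev.
have bv := ostrowski_bound hd hv; have bw := ostrowski_bound hd hw.
have D0 := Dseq_gt0 (size w) hd.
rewrite es in ev bv.
have eab : a = b.
  have := congr1 (divn^~ (Dseq d (size w).+1)) ev.
  by rewrite ![_ + _ * _]addnC !divnMDl // !divn_small // !addn0.
rewrite eab in ev *; move/addIn: ev => ev.
by rewrite (IH w).
Qed.

Lemma trimmed_size d w : 1 < d -> trimmed d w ->
  Dseq d (size w) <= value d w < Dseq d (size w).+1.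
Proof.
move=> hd /and3P[hw hl _]; rewrite (ostrowski_bound hd hw) andbT.
case/lastP: w hl {hw} => [|w c] //; rewrite last_rcons -lt0n => c0.
rewrite value_rcons size_rcons.
by apply: leq_trans (leq_addl _ _); rewrite leq_pmull.
Qed.

Lemma Dseq_homo d m n : 1 < d -> m <= n -> Dseq d m <= Dseq d n.
Proof.
move=> hd /subnK <-; elim: (n - m) => // k IH.
by rewrite addSn; apply: leq_trans IH (ltnW (Dseq_ltS _ hd)).
Qed.

Lemma trimmed_inj d v w : 1 < d -> trimmed d v -> trimmed d w ->
  value d v = value d w -> v = w.
Proof.
move=> hd tv tw ev.
apply: (@ostrowski_inj d) => //; [by case/andP: tv | by case/andP: tw | ].
have /andP[lv uv] := trimmed_size hd tv; have /andP[lw uw] := trimmed_size hd tw.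
rewrite ev in lv uv.
case: (ltngtP (size v) (size w)) => // h.
  by have := leq_trans uv (leq_trans (Dseq_homo hd h) lw); rewrite ltnn.
by have := leq_trans uw (leq_trans (Dseq_homo hd h) lv); rewrite ltnn.
Qed.

Lemma trimmed_value_dec d : 1 < d ->
  {P : pred nat & forall N,
    reflect (exists w, trimmed d w && (value d w == N)) (P N)}.
Proof.
move=> hd; exists (fun N => [exists k : 'I_N.+1, [exists t : k.-tuple 'I_d.+1,
  trimmed d (map val t) && (value d (map val t) == N)]]) => N.
apply: (iffP existsP) => [[k /existsP[t ht]]|[w /andP[tw /eqP vw]]].
  by exists (map val t).
have sw : size w < N.+1.
  rewrite ltnS -vw; apply: leq_trans (leq_Dseq _ hd) _.
  by case/andP: (trimmed_size hd tw).
have hs : size (map (@inord d) w) == Ordinal sw by rewrite size_map.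
exists (Ordinal sw); apply/existsP; exists (Tuple hs) => /=.
have -> : map val (map (@inord d) w) = w.
  rewrite -map_comp; apply: map_id_in => c hc /=; rewrite inordK //.
  by case/and3P: tw => /and3P[_ /allP h _] _ _; exact: h.
by rewrite tw vw eqxx.
Qed.

Lemma trimmed_unbounded d x : 1 < d -> exists2 w, trimmed d w & x < value d w.
Proof.
move=> hd; pose w := rcons (1 :: nseq x 0) 1.
have tw : trimmed d w.
  rewrite /trimmed /ostrowski /w rcons_cons /= hd (ltnW hd) /= all_rcons.
  rewrite (ltnW hd) all_nseq leq0n orbT last_rcons /= andbT.
  have h1 : (1 == d) = false by rewrite ltn_eqF.
  have h0 : (0 == d) = false by rewrite ltn_eqF // ltnW.
  rewrite rcons_path h1 /= andbT.
  by case: x {w} => //= n; rewrite h0 /=; elim: n => //= n ->; rewrite h0.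
exists w => //; have /andP[h _] := trimmed_size hd tw.
apply: leq_trans h; apply: leq_trans (leq_Dseq _ hd).
by rewrite size_rcons /= size_nseq.
Qed.

Lemma trimmed_listing_exists d : 1 < d -> exists w, trimmed_listing d w.
Proof.
move=> hd; have [P PP] := trimmed_value_dec hd.
have ex x : exists N, P N && (x < N).
  have [w tw xw] := trimmed_unbounded x hd; exists (value d w); rewrite xw andbT.
  by apply/PP; exists w; rewrite tw eqxx.
pose next x := ex_minn (ex x); pose s m := iter m next 0.
have sS m : [/\ P (s m.+1), s m < s m.+1
              & forall N, P N -> s m < N -> s m.+1 <= N].
  rewrite /s iterS -/(s m) /next; case: ex_minnP => N /andP[h1 h2] h3.
  by split=> // M h4 h5; apply: h3; rewrite h4.
have shomo : {homo s : i j / i < j}.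
  by apply: homo_ltn => [|m]; [exact: ltn_trans | case: (sS m)].
have hw m : {w | (0 < m) ==> trimmed d w && (value d w == s m)}.
  apply: sigW; case: m => [|m]; first by exists [::].
  by have [/PP] := sS m.
have wP m : 0 < m -> trimmed d (sval (hw m)) /\ value d (sval (hw m)) = s m.
  by move=> m0; case: (hw m) => w /=; rewrite m0 => /andP[? /eqP].
exists (fun m => sval (hw m)); split=> [m /wP[]// | v tv | m1 m2 h1 h2]; last first.
  by rewrite !(proj2 (wP _ _)) ?shomo // (ltn_trans h1).
have Pv : P (value d v) by apply/PP; exists v; rewrite tv eqxx.
have v0 : 0 < value d v.
  have /andP[h _] := trimmed_size hd tv; apply: leq_trans h.
  by case: v tv {Pv} => [|a v _] /=; [rewrite /trimmed /= andbF | exact: Dseq_gt0].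
have sge m : m <= s m.
  by elim: m => // m IH; apply: leq_ltn_trans IH _; case: (sS m).
have [m m0 sm] : exists2 m, 0 < m & s m = value d v.
  have exm : exists m, value d v <= s m by exists (value d v).
  case: (ex_minnP exm) => -[|m] h1 h2; first by move: v0; rewrite ltnNge h1.
  exists m.+1 => //; apply/eqP; rewrite eqn_leq h1 andbT.
  have [_ _] := sS m; apply=> //; rewrite ltnNge; apply/negP => /h2.
  by rewrite ltnn.
exists m => //; have [tm vm] := wP _ m0.
by apply: (trimmed_inj hd tm tv); rewrite vm.
Qed.

(* Main.v *)
(* Existence and uniqueness of Ostrowski words with nonzero last digit, together
   with the removal of leading zeros, give (2).  For (3), let
   [cross x y K = D_K * y - D_(K+1) * x], for K large an integer counterpart of
   [y - alpha * x], where alpha is the limit of the ratios of consecutive D_n.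
   If v is an Ostrowski word, the value of [cross] at the pair represented by
   (v, 0v) lies in the interval [D_(K-1) - D_K, D_(K-1)], of length D_K.  At the
   pair (B_n, B_(n+1)), [cross] only changes sign when n and K both increase
   by 1, so for n large it is smaller than D_(K-1) in absolute value.  If v
   represents B_n, the two values are congruent modulo D_K and differ by less
   than D_K, so they are equal, i.e. 0v represents B_(n+1). *)
Require Import Defs.
From mathcomp Require Import all_boot all_order all_algebra.
From mathcomp Require Import zify ring.

(** * Existence and uniqueness of Ostrowski words, and leading zeros *)

Section OstrowskiWords.

Variable d : nat.

Lemma value_cons0 c v : value d (c :: v) = c + value d (0 :: v).
Proof.
rewrite /value /= !big_ord_recl /= muln1 mul0n add0n.
by congr (_ + _).
Qed.

Lemma value_cons0_cons c v :
  value d (0 :: c :: v) = d * value d (c :: v) + value d v.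
Proof.
rewrite /value /= !big_ord_recl /= [d * (_ + _)]mulnDr big_distrr -addnA.
rewrite -big_split /= mul0n add0n; congr (_ + _); first by ring.
by apply: eq_bigr => j _; rewrite /=; ring.
Qed.

Lemma ostrowski_cons0 v : 1 < d -> ostrowski d v -> ostrowski d (0 :: v).
Proof.
move=> hd /and3P[h1 h2 h3]; rewrite /ostrowski /= (ltnW hd) h2 /=.
case: v h1 h2 h3 => //= a v h1 _ ->.
by rewrite (ltn_eqF h1).
Qed.

Lemma ostrowski_zeros n v : 1 < d -> ostrowski d v -> ostrowski d (nseq n 0 ++ v).
Proof. by move=> hd hv; elim: n => //= n; apply: ostrowski_cons0. Qed.

Lemma ostrowski_rcons_lt v c : 1 < d -> ostrowski d v -> c < d ->
  ostrowski d (rcons v c).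
Proof.
move=> hd /and3P[h1 h2 h3] hc; rewrite /ostrowski all_rcons (ltnW hc) h2.
case: v h1 h2 h3 => [|a v] /= h1 _ h3; first by rewrite hc.
by rewrite h1 rcons_path h3 (ltn_eqF hc).
Qed.

Lemma ostrowski_rcons0d v : 1 < d -> ostrowski d v ->
  ostrowski d (rcons (rcons v 0) d).
Proof.
move=> hd hv.
have /and3P[h1 h2 h3] := ostrowski_rcons_lt v 0 hd hv (ltnW hd).
rewrite /ostrowski all_rcons leqnn h2.
case: v {hv} h1 h2 h3 => [|a v] /= h1 _ h3; first by rewrite (ltnW hd) implybT.
by rewrite h1 rcons_path h3 last_rcons implybT.
Qed.

(** Greedy division by the weight of the last digit. If the quotient is [d], the bound on [N] forces
    the remainder below the preceding weight, so the preceding digit can be 0. Allowing zeros at the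
    end of the word lets small remainders fit the prescribed size. *)
Lemma ostrowski_word_of_size n N : 1 < d -> N < Dseq d n.+1 ->
  exists v, [/\ ostrowski d v, size v = n & value d v = N].
Proof.
move=> hd; have [m] := ubnP n; elim: m n N => // m IH [|[|n]] N hm hN.
- exists [::]; split=> //; first by rewrite /ostrowski /= (ltnW hd).
  by rewrite /value big_ord0; case: N hN.
- have hNd : N < d by move: hN; rewrite /= muln1 addn0.
  exists [:: N]; split=> //; first by rewrite /ostrowski /= hNd (ltnW hNd).
  by rewrite /value big_ord1 /= muln1.
have D0 := Dseq_gt0 n.+1 hd.
have hr := ltn_pmod N D0; have eN := divn_eq N (Dseq d n.+2).
set c := N %/ _ in eN; set r := N %% _ in eN hr.
rewrite DseqSS in hN.
have D1 := Dseq_ltS n.+1 hd.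
case: (ltnP c d) => hc.
  have [|v [ov sv vv]] := IH n.+1 r _ hr; first by lia.
  exists (rcons v c); split; first exact: ostrowski_rcons_lt.
    by rewrite size_rcons sv.
  by rewrite value_rcons sv vv eN addnC.
have ec : c = d.
  apply/eqP; rewrite eqn_leq hc andbT -ltnS -(ltn_pmul2r D0) mulSn.
  by lia.
have [||v [ov sv vv]] := IH n r; [by lia | by rewrite ec in eN; lia |].
exists (rcons (rcons v 0) d); split; first exact: ostrowski_rcons0d.
  by rewrite !size_rcons sv.
by rewrite !value_rcons size_rcons sv vv mul0n addn0 eN ec addnC.
Qed.

Lemma ostrowski_word_exists N : 1 < d -> 0 < N ->
  exists v, [/\ ostrowski d v, last 0 v != 0 & value d v = N].
Proof.
move=> hd N0.
have ex : exists n, N < Dseq d n.+1 by exists N; apply: leq_Dseq.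
(* Minimality of [n] makes the last digit nonzero: a final 0 could be dropped, and the shorter word
   would bound [N] by a smaller term. *)
case: (ex_minnP ex) => n hn hmin.
have [v [ov sv vv]] := ostrowski_word_of_size n N hd hn.
exists v; split=> //; apply/eqP => l0.
case/lastP: v l0 ov sv vv => [|v c].
  by move=> _ _ _; rewrite /value big_ord0 => e; rewrite -e in N0.
rewrite last_rcons => -> /(ostrowski_rcons hd)[ov _ _ _].
rewrite size_rcons value_rcons mul0n addn0 => sv vv.
have := ostrowski_bound hd ov; rewrite vv => /hmin; rewrite -sv.
by rewrite ltnn.
Qed.

Lemma ostrowski_size v : 1 < d -> ostrowski d v -> last 0 v != 0 ->
  Dseq d (size v) <= value d v < Dseq d (size v).+1.
Proof.
move=> hd ov; rewrite (ostrowski_bound hd ov) andbT.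
case/lastP: v {ov} => [|v c] //; rewrite last_rcons -lt0n => c0.
by rewrite value_rcons size_rcons (leq_trans _ (leq_addl _ _)) ?leq_pmull.
Qed.

Lemma ostrowski_word_unique u v : 1 < d ->
  ostrowski d u -> last 0 u != 0 -> ostrowski d v -> last 0 v != 0 ->
  value d u = value d v -> u = v.
Proof.
move=> hd ou lu ov lv e; apply: (@ostrowski_inj d) => //.
have /andP[u1 u2] := ostrowski_size u hd ou lu.
have /andP[v1 v2] := ostrowski_size v hd ov lv.
case: (ltngtP (size u) (size v)) => // /(Dseq_homo hd); lia.
Qed.

Lemma ostrowski_trim v : ostrowski d v -> last 0 v != 0 ->
  exists n u, trimmed d u /\ v = nseq n 0 ++ u.
Proof.
elim: v => [|c v IH] // ov lv.
case: (boolP (trimmed d (c :: v))) => [tv|]; first by exists 0, (c :: v).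
rewrite /trimmed ov lv /=; case: c ov lv => // ov lv /negPn ov'.
have lv' : last 0 v != 0 by case: v lv {IH ov ov'}.
by have [n [u [tu ->]]] := IH ov' lv'; exists n.+1, u.
Qed.

Lemma last_zeros n v : last 0 v != 0 -> last 0 (nseq n 0 ++ v) != 0.
Proof. by case: v => //= a v; rewrite last_cat. Qed.

Lemma trimmed_zeros_inj a b u v :
  trimmed d u -> trimmed d v -> 1 < d ->
  nseq a 0 ++ u = nseq b 0 ++ v -> a = b /\ u = v.
Proof.
move=> tu tv hd.
(* Removing one zero from [nseq n.+1 0 ++ y] leaves an Ostrowski word, so this word is not
   trimmed. *)
have not_pad n x y : trimmed d x -> trimmed d y -> x <> nseq n.+1 0 ++ y.
  move=> /and3P[_ _ h] /and3P[oy _ _] e; move: h; rewrite e /=.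
  by rewrite ostrowski_zeros.
elim: a b => [|a IH] [|b] //= e.
- by case: (not_pad b u v tu tv).
- by case: (not_pad a v u tv tu).
by case: e => /IH[-> ->].
Qed.

End OstrowskiWords.

(** * Prepending a zero follows the recurrence on large terms *)

Section Shift.

Import GRing.Theory Num.Theory.
Local Open Scope ring_scope.

Variable d : nat.

Definition cross (x y K : nat) : int :=
  (Dseq d K)%:Z * y%:Z - (Dseq d K.+1)%:Z * x%:Z.

Lemma cross_step x y K : cross y (d * y + x)%N K.+1 = - cross x y K.
Proof. by rewrite /cross DseqSS !PoszD !PoszM; ring. Qed.

(** Prepending [c] is one recurrence step, which negates [cross], plus [c] times the pair (1, d),
    where [cross] is d * D_(K+1) - D_(K+2) = - D_K. *)
Lemma cross_cons c v K :
  cross (value d (c :: v)) (value d (0%N :: c :: v)) K.+1 =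
  - (c%:Z * (Dseq d K)%:Z) - cross (value d v) (value d (0%N :: v)) K.
Proof.
rewrite value_cons0_cons [value d (c :: v)]value_cons0 /cross DseqSS.
by rewrite !PoszD !PoszM !PoszD; ring.
Qed.

(** Induction from the first digit. The tail of an Ostrowski word may begin with [d], so the
    induction carries the weaker lower bound; a first digit below [d] then gains one multiple of
    D_K. *)
Lemma cross_bound v K : (1 < d)%N -> all (leq^~ d) v -> (size v <= K)%N ->
  [/\ cross (value d v) (value d (0%N :: v)) K.+1 <= (Dseq d K)%:Z,
      - (Dseq d K.+1)%:Z <= cross (value d v) (value d (0%N :: v)) K.+1
    & (head 0%N v < d)%N -> (Dseq d K)%:Z - (Dseq d K.+1)%:Z <=
        cross (value d v) (value d (0%N :: v)) K.+1].
Proof.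
move=> hd; elim: v K => [|c v IH] K.
  move=> _ _; have D1 := Dseq_ltS K hd.
  have -> : value d [::] = 0%N by rewrite /value big_ord0.
  have -> : value d [:: 0%N] = 0%N by rewrite /value big_ord1.
  by rewrite /cross; split; lia.
case/andP=> hc hv; case: K => // K hK.
have [h1 h2 _] := IH K hv hK; rewrite cross_cons.
set F := cross _ _ _ in h1 h2 *.
have hcd (e : nat) : (c + e <= d)%N ->
    c%:Z * (Dseq d K.+1)%:Z + e%:Z * (Dseq d K.+1)%:Z <=
    d%:Z * (Dseq d K.+1)%:Z.
  by move=> he; rewrite -mulrDl -PoszD -!PoszM lez_nat leq_mul2r he orbT.
have c0 : 0 <= c%:Z * (Dseq d K.+1)%:Z by [].
have e0 := hcd 0%N; rewrite addn0 mul0r addr0 in e0; have {}e0 := e0 hc.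
rewrite DseqSS PoszD PoszM; split; [by lia | by lia |].
by move=> hc'; have := hcd 1%N; rewrite addn1 mul1r => /(_ hc'); lia.
Qed.

Lemma muln_Dseq_lt k m : (1 < d)%N -> (m * Dseq d k.+1 < Dseq d (m + k.+1))%N.
Proof.
move=> hd; elim: m => [|m IH]; first exact: Dseq_gt0.
have D0 := Dseq_gt0 k hd.
have D1 := Dseq_homo hd (leq_addl m k.+1).
have hD : (2 * Dseq d (m + k.+1) <= Dseq d (m.+1 + k.+1))%N.
  rewrite !addnS addSn DseqSS; apply: leq_trans (leq_addr _ _).
  by rewrite leq_mul2r hd orbT.
by rewrite mulSn; lia.
Qed.

Lemma cross_iter (B : nat -> nat) K n :
  (forall n, (0 < n)%N -> B n.+2 = (d * B n.+1 + B n)%N) ->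
  `|cross (B n.+1) (B n.+2) (n + K)| = `|cross (B 1%N) (B 2%N) K|.
Proof.
move=> hB; elim: n => // n IH.
by rewrite (hB n.+1) // addSn cross_step normrN.
Qed.

Lemma recurrence_shift (B : nat -> nat) : (1 < d)%N ->
  (forall n, (0 < n)%N -> B n.+2 = (d * B n.+1 + B n)%N) ->
  exists n0, forall v, ostrowski d v -> value d v = B n0.+1 ->
    value d (0%N :: v) = B n0.+2.
Proof.
(* The initial [cross] is at most C * D_(K+1) in absolute value, and C index steps absorb the factor
   C by [muln_Dseq_lt]. Since C does not involve K, the same [n0] serves words [v] of every size
   K. *)
move=> hd hB; pose C := (B 1%N + B 2%N)%N; exists C.+2 => v ov vv.
pose K := size v.
have hsz : (size v <= C.+1 + K)%N by rewrite leq_addl.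
have /and3P[hh hall _] := ov.
have [h1 _ /(_ hh) h3] := cross_bound v (C.+1 + K) hd hall hsz.
have hE := cross_iter B K C.+2 hB.
have hgrow := muln_Dseq_lt K C hd.
have hE1 : `|cross (B 1%N) (B 2%N) K| <= (C * Dseq d K.+1)%N%:Z.
  have D1 := Dseq_ltS K hd.
  rewrite /cross /C mulnDl PoszD -!PoszM.
  have := leq_mul (ltnW D1) (leqnn (B 2%N)).
  by rewrite (mulnC (B 1%N)) (mulnC (B 2%N)); lia.
have hD : (2 * Dseq d (C.+1 + K) <= Dseq d (C.+1 + K).+1)%N.
  rewrite addSn DseqSS; apply: leq_trans (leq_addr _ _).
  by rewrite leq_mul2r hd orbT.
have eK : (C + K.+1 = C.+1 + K)%N by lia.
rewrite eK in hgrow; rewrite vv in h1 h3.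
rewrite addSn in hE.
set E := cross _ (B _) _ in hE; set F := cross _ _ _ in h1 h3.
set M := Dseq d (C.+1 + K).+1 in hD h3.
have eEF : E - F = M%:Z * ((B C.+4)%:Z - (value d (0%N :: v))%:Z).
  by rewrite /E /F /cross -/M; ring.
(* With L = D_(C+1+K), |E| < L and L - M <= F <= L. Hence E - F < M, and E - F > - 2L >= - M by
   [hD]. *)
have lt1 : `|E - F| < M%:Z by lia.
move: lt1; rewrite eEF normrM ger0_norm // => lt1.
case: (eqVneq (B C.+4) (value d (0%N :: v))) => // neq.
have ge1 : 1 <= `|(B C.+4)%:Z - (value d (0%N :: v))%:Z| by lia.
by have := ler_peMr (isT : 0 <= M%:Z) ge1; lia.
Qed.

End Shift.

Theorem theorem1 (d : nat) (hd : 2 <= d)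
  (w : nat -> seq nat) (hw : trimmed_listing d w) :
  stolarsky_array d (ostrowski_array d w).
Proof.
case: hw => wT wS wM; split.
- move=> m [|[|n]] _ // _; rewrite /ostrowski_array /=.
  exact: value_cons0_cons.
- move=> k k0; have [v [ov lv vv]] := ostrowski_word_exists d k hd k0.
  have [n [u [tu ev]]] := ostrowski_trim d v ov lv.
  have [m m0 wm] := wS u tu.
  exists (m, n.+1); split=> /=.
    by split=> //; rewrite /ostrowski_array /= wm -ev.
  case=> m' n' [/= m'0 n'0].
  rewrite /ostrowski_array -vv => e.
  have tm := wT m' m'0.
  have /and3P[om lm _] := tm.
  have e2 : nseq n'.-1 0 ++ w m' = v.
    by apply: (ostrowski_word_unique d) => //;
       [exact: ostrowski_zeros | exact: last_zeros].
  rewrite ev -wm in e2.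
  have [|e3 e4] := trimmed_zeros_inj d _ _ _ _ tm _ hd e2; first exact: wT.
  congr (_, _); last by lia.
  case: (ltngtP m m') => // h; first by have := wM _ _ m0 h; rewrite e4 ltnn.
  by have := wM _ _ m'0 h; rewrite e4 ltnn.
move=> B B0 BR.
have hB n : 0 < n -> B n.+2 = d * B n.+1 + B n by move=> n0; rewrite BR.
have [n0 hn0] := recurrence_shift d B hd hB.
have [v [ov lv vv]] := ostrowski_word_exists d _ hd (B0 n0.+1 isT).
have [a [u [tu ev]]] := ostrowski_trim d v ov lv.
have [m m0 wm] := wS u tu.
exists m => //.
have hk k : value d (nseq k 0 ++ v) = B (n0.+1 + k) /\
            value d (nseq k.+1 0 ++ v) = B (n0.+1 + k.+1).
  elim: k => [|k [IH1 IH2]]; first by rewrite addn0 addn1 /= hn0.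
  split=> //; have := value_cons0_cons d 0 (nseq k 0 ++ v) => /= ->.
  by rewrite [value d (0 :: _)]IH2 IH1 !addnS hB ?addSn.
(* As v = 0^a w_m, for n > a the word 0^(n-1) w_m is 0^(n-1-a) v, which represents B at index n0 + 1
   + (n-1-a) = n + (n0 - a). *)
exists (Posz n0 - Posz a)%R, a.+1 => n k hn ek.
have -> : k = n0.+1 + (n.-1 - a) by lia.
rewrite -(proj1 (hk _)) ev catA -nseqD subnK; last by lia.
by rewrite /ostrowski_array wm.
Qed.
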